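(* Let $W_n(x)$ be the interior peak polynomials. Then for $n\ge1$, $$W_{n+1}(x)=\sum_{T\in\mathrm{SYT}(n;2)}2^{\ell(\lambda(T))}\left(\prod_{i=1}^n\sigma_i(T)\right)x^{n-\ell(\lambda(T))}.$$
   Context: $W_n(x)=\sum_{\pi\in\mathfrak S_n}x^{\mathrm{ipk}(\pi)}$, where $\mathfrak S_n$ is the symmetric group on $[n]$ and $\mathrm{ipk}(\pi)=\#\{i: 2\le i\le n-1,\ \pi(i-1)<\pi(i)>\pi(i+1)\}$. A standard Young tableau of size $n$ is a filling of the Ferrers diagram of a partition $\lambda\vdash n$ (French convention: left-justified rows numbered from bottom to top, $\lambda_i$ boxes in row $i$) with $1,\dots,n$, each used exactly once, increasing from left to right in rows and from bottom to top in columns; $\mathrm{SYT}(n)$ is the set of all of them, and $\mathrm{SYT}(n;k)$ is the subset of those with at most $k$ columns. For $T\in\mathrm{SYT}(n)$, $\ell(\lambda(T))$ is the number of rows of $T$, $T_i$ is the tableau obtained from $T$ by deleting the entries $i+1,\dots,n$, and $\mathrm{col}_k(T_i)$ is the number of boxes in the $k$-th column of $T_i$. The box sorting index of $i$ is $$\sigma_i(T)=\begin{cases} i-\mathrm{col}_1(T_i)+1, & \text{if } i \text{ is in the first column of } T,\\ \mathrm{col}_k(T_i)-\mathrm{col}_{k+1}(T_i)+1, & \text{if } i \text{ is in the } (k+1)\text{-th column of } T,\ k\ge1.\end{cases}$$ *)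

(* Defs.v *)
From HB Require Import structures.
From mathcomp Require Import all_boot all_order all_fingroup all_algebra.

Set Implicit Arguments.
Unset Strict Implicit.
Unset Printing Implicit Defensive.

Import GRing.Theory.

(* Positions and values of a permutation are 0-based.  The existence of both
   neighbours [a] and [b] in ['I_n] is the condition that [i] be interior. *)
Definition ipk (n : nat) (s : 'S_n) : nat :=
  #|[set i : 'I_n | [exists a : 'I_n, exists b : 'I_n,
      [&& (i : nat) == a.+1, (b : nat) == i.+1, s a < s i & s b < s i]]]|.

Definition W (n : nat) : {poly int} := (\sum_(s : 'S_n) 'X^(ipk s))%R.

Definition is_partition (n : nat) (la : seq nat) : bool :=
  [&& sorted geq la, 0 \notin la & sumn la == n].

(* A tableau is the list of its rows, from bottom to top.
   Columns are numbered from 1 and read from bottom to top. *)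
Definition column (k : nat) (T : seq (seq nat)) : seq nat :=
  [seq nth 0 r k.-1 | r <- T & k <= size r].

Definition col_size (k : nat) (T : seq (seq nat)) : nat := size (column k T).

Definition is_standard (n : nat) (T : seq (seq nat)) : bool :=
  [&& is_partition n (shape T),
      perm_eq (flatten T) (iota 1 n),
      all (sorted ltn) T
    & all (fun k => sorted ltn (column k T)) (iota 1 n)].

(* A finite carrier: a standard tableau of size n has at most n rows, each of
   length at most n, with entries at most n. *)
Definition filling (n : nat) := n.-bseq (n.-bseq 'I_n.+1).

Definition rows (n : nat) (T : filling n) : seq (seq nat) :=
  [seq [seq nat_of_ord x | x <- bseqval r] | r <- bseqval T].

Definition SYT (n : nat) : {set filling n} :=
  [set T | is_standard n (rows T)].

Definition SYT_cols (n k : nat) : {set filling n} :=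
  [set T in SYT n | all (fun c => c <= k) (shape (rows T))].

(* [restrict T i] deletes the entries greater than [i]; rows left without
   boxes are dropped. *)
Definition restrict (T : seq (seq nat)) (i : nat) : seq (seq nat) :=
  [seq r <- [seq [seq x <- r | x <= i] | r <- T] | r != [::]].

Definition column_of (i : nat) (T : seq (seq nat)) : nat :=
  (index i (nth [::] T (find (fun r => i \in r) T))).+1.

(* On standard tableaux with 1 <= i <= n neither subtraction is truncated. *)
Definition box_sorting_index (i : nat) (T : seq (seq nat)) : nat :=
  let c := column_of i T in
  if c == 1 then i - col_size 1 (restrict T i) + 1
  else col_size c.-1 (restrict T i) - col_size c (restrict T i) + 1.

(* Main.v *)
Require Import Defs.
From HB Require Import structures.
From mathcomp Require Import all_boot all_order all_fingroup all_algebra.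
From mathcomp Require Import zify ring.

Set Implicit Arguments.
Unset Strict Implicit.
Unset Printing Implicit Defensive.

Import GRing.Theory.

(** Both sides satisfy the recurrence
      [P_0 = 1],  [P_(n+1) = (2 + n X) P_n + 2 X (1 - X) P_n'],
    whose right-hand side is [peak_step n P_n].  On monomials the step is
      [X^k |-> 2 (k+1) X^k + (n - 2k) X^(k+1)].

    For the peak polynomials [P_n = W (n+1)], every permutation of [n+2] letters
    arises once by inserting the largest letter into a permutation [s] of [n+1]
    letters.  The inserted letter is a peak unless it is put at an end, and it
    destroys a peak of [s] when it is put next to it; peaks are never adjacent,
    so at most one is destroyed.  Hence, if [s] has [k] peaks, the [2 k + 2]
    slots next to a peak or at an end keep the number of peaks, and the other
    [n - 2k] slots raise it by one ([peaks_insert_max], [sum_flat_slot]).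

    For the tableaux, a standard tableau with at most two columns is the pair
    [(A, B)] of its columns ([two_col], [ballot_pair]).  Each one of size [n+1]
    arises once from one of size [n] by putting [n+1] on top of the first
    column, or on top of the second one if [|B| < |A|].  The box sorting index
    of [n+1] is [|B| + 1] in the first case and [|A| - |B|] in the second, and
    the indices of the smaller entries do not change.  With [b = |B|],
    [|A| = n - b] and [w] the product of the indices, the term [2^|A| w X^b]
    thus yields
      [2^(|A|+1) (b+1) w X^b + 2^|A| (n - 2b) w X^(b+1)],
    which is [peak_step n] of it ([pair_term_step]).  The case [|A| = |B|], in
    which the second move is forbidden, is consistent because [n - 2b]
    vanishes. *)

(** * The common recurrence *)

Definition peak_step (n : nat) (p : {poly int}) : {poly int} :=
  ((2%:R + n%:R *: 'X) * p + 2%:R *: ('X * (1 - 'X)) * p^`())%R.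

Lemma peak_step_sum n (I : Type) (r : seq I) (F : I -> {poly int}) :
  peak_step n (\sum_(i <- r) F i)%R = (\sum_(i <- r) peak_step n (F i))%R.
Proof.
apply: (big_morph (peak_step n)) => [p q|].
  by rewrite /peak_step derivD !mulrDr addrACA.
by rewrite /peak_step deriv0 !mulr0 addr0.
Qed.

Lemma peak_stepZXn n (c : int) k :
  peak_step n (c *: 'X^k)%R =
  (c *: ((2 * k.+1)%:R *: 'X^k + (n%:R - (2 * k)%:R) *: 'X^(k.+1)))%R.
Proof.
rewrite /peak_step derivZ derivXn -!scalerAr -scalerDr; congr (_ *: _)%R.
rewrite -!mul_polyC !rmorphB !rmorph_nat -mulr_natr exprS.
by case: k => [|k]; rewrite ?exprS /=; ring.
Qed.

(** * Inserting the largest letter into a permutation *)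

Definition is_peak (m : nat) (f : nat -> nat) (i : nat) : bool :=
  [&& 0 < i, i.+1 < m, f i.-1 < f i & f i.+1 < f i].

(** The slots, numbered from 0 to [m], into which a new maximum can be inserted
    without changing the number of peaks.  Slot [j] lies between positions
    [j.-1] and [j]. *)
Definition flat_slot (m : nat) (f : nat -> nat) (j : nat) : bool :=
  [|| j == 0, j == m, is_peak m f j | (0 < j) && is_peak m f j.-1].

(** [bump j] is the increasing enumeration of the positions other than [j], so
    [g] restricted to these positions is [f] on its first [m] arguments. *)
Definition inserts_max (m : nat) (f g : nat -> nat) (j : nat) : Prop :=
  forall i, i < m -> g (bump j i) = f i /\ f i < g j.

Lemma is_peak_insert_max m f g j :
  j <= m -> inserts_max m f g j -> is_peak m.+1 g j = (0 < j < m).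
Proof.
move=> lejm ins; rewrite /is_peak ltnS andbA.
case: (posnP j) => //= j_gt0; case: ltnP => //= ltjm.
have [|e1 l1] := ins j.-1; first by lia.
have [|e2 l2] := ins j; first by lia.
have bj' : bump j j.-1 = j.-1 by rewrite /bump; lia.
have bj : bump j j = j.+1 by rewrite /bump leqnn.
by rewrite -{1}bj' -bj e1 e2 l1 l2.
Qed.

(** The old letters keep their neighbours except those on either side of slot
    [j], which have acquired a larger neighbour. *)
Lemma is_peak_insert_bump m f g j i :
  i < m -> j <= m -> inserts_max m f g j ->
  is_peak m.+1 g (bump j i) = is_peak m f i && (i != j) && (i.+1 != j).
Proof.
move=> ltim lejm ins.
have [gi fi] := ins _ ltim.
case: (eqVneq i j) => [eij|neij].
  rewrite /= andbF; apply/negbTE; rewrite /is_peak; subst j.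
  apply/negP => /and4P[_ _ + _]; rewrite gi /bump leqnn /=.
  by rewrite ltnNge ltnW.
case: (eqVneq i.+1 j) => [eij|neij'].
  rewrite /= andbF; apply/negbTE; rewrite /is_peak; subst j.
  rewrite gi /bump ltnn /= add0n; apply/negP => /and4P[_ _ _ +].
  by rewrite ltnNge ltnW.
rewrite !andbT /is_peak gi.
case: (posnP i) => [i0|i_gt0].
  by rewrite i0 /bump; case: j {ins gi fi lejm} neij neij' => [|j]; lia.
have -> : (0 < bump j i) by rewrite /bump; lia.
have -> : (bump j i).-1 = bump j i.-1 by rewrite /bump; lia.
have [-> _] := ins i.-1 ltac:(lia).
have -> : (bump j i).+1 = bump j i.+1 by rewrite /bump; lia.
case: (ltnP i.+1 m) => ltSim; last first.
  by have -> : bump j i.+1 < m.+1 = false by rewrite /bump; lia.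
have [-> _] := ins i.+1 ltSim.
by have -> : bump j i.+1 < m.+1 by rewrite /bump; lia.
Qed.

Lemma is_peakN m f i : is_peak m f i -> ~~ is_peak m f i.+1.
Proof.
move=> /and4P[_ _ _ lt1]; apply/negP => /and4P[_ _ /= lt2 _].
by move: (ltn_trans lt1 lt2); rewrite ltnn.
Qed.

Lemma peaks_at_slot m f j :
  j <= m ->
  \sum_(i < m) (is_peak m f i && ((i == j :> nat) || (i.+1 == j))) =
  is_peak m f j + (0 < j) && is_peak m f j.-1.
Proof.
move=> lejm.
transitivity (\sum_(i < m | i == j :> nat) is_peak m f i
            + \sum_(i < m | i.+1 == j :> nat) is_peak m f i).
  rewrite [X in _ = X + _]big_mkcond [X in _ = _ + X]big_mkcond -big_split /=.
  apply: eq_bigr => i _; case: eqP => [<-|_] /=;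
    last by case: eqP; rewrite ?andbT ?andbF.
  by rewrite andbT; case: eqP => [/esym/n_Sn|]; rewrite ?addn0.
congr (_ + _).
  case: (ltnP j m) => [ltjm|lemj].
    by rewrite (big_pred1 (Ordinal ltjm)).
  rewrite big_pred0 => [|i]; last
    by apply/negbTE; rewrite ltn_eqF // (leq_trans (ltn_ord i)).
  by rewrite /is_peak; case: (ltnP j.+1 m); rewrite ?andbF //; lia.
case: j lejm => [|j] ltjm /=; first by rewrite big_pred0.
by rewrite (big_pred1 (Ordinal ltjm)).
Qed.

(** An insertion next to a peak trades that peak for the new one, an insertion
    at an end creates none, and the two situations exclude each other and, by
    [is_peakN], happen at most once. *)
Lemma peaks_insert_max m f g j :
  0 < m -> j <= m -> inserts_max m f g j ->
  \sum_(i < m.+1) is_peak m.+1 g i + flat_slot m f j =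
  (\sum_(i < m) is_peak m f i).+1.
Proof.
move=> m_gt0 lejm ins.
have ltj : j < m.+1 by [].
rewrite (bigD1_ord (Ordinal ltj)) //= (is_peak_insert_max lejm ins).
transitivity ((\sum_(i < m) (is_peak m f i && (i != j :> nat) && (i.+1 != j)) +
   \sum_(i < m) (is_peak m f i && ((i == j :> nat) || (i.+1 == j)))).+1); last first.
  congr _.+1; rewrite -big_split /=; apply: eq_bigr => i _.
  by case: is_peak; case: eqP; case: eqP.
under eq_bigr => i _ do rewrite (is_peak_insert_bump (ltn_ord i) lejm ins).
rewrite (peaks_at_slot f lejm) /flat_slot.
have := @is_peakN m f j.-1.
have : is_peak m f j -> 0 < j < m by move=> /and4P[-> /ltnW ->].
have : is_peak m f j.-1 -> j < m by move=> /and4P[? ? _ _]; lia.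
case: (posnP j) => [->|j_gt0] /=; first by case: is_peak => [_ /(_ isT)//|] ; lia.
rewrite prednK //; case: (is_peak m f j.-1) => [/(_ isT) H1 _ /(_ isT) /negbTE ->|_].
  by rewrite H1 (ltn_eqF H1) /= ?(gtn_eqF j_gt0); lia.
case: (is_peak m f j) => [/(_ isT) /= H1 _|_ _].
  by rewrite H1 (ltn_eqF H1) /= ?(gtn_eqF j_gt0); lia.
by rewrite ?(gtn_eqF j_gt0) /= orbF ltn_neqAle lejm andbT; case: eqP => _ /=; lia.
Qed.

(** Each peak is adjacent to two slots, no two peaks share a slot, and the two
    end slots touch no peak. *)
Lemma sum_flat_slot m f :
  0 < m -> \sum_(j < m.+1) flat_slot m f j = 2 * (\sum_(i < m) is_peak m f i).+1.
Proof.
move=> m_gt0.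

have pkm : is_peak m f m = false by rewrite /is_peak; lia.
have pkm' : is_peak m f m.-1 = false by rewrite /is_peak; lia.
transitivity (\sum_(j < m.+1) ((j == 0 :> nat) + (j == m :> nat)
     + (is_peak m f j + (0 < j) && is_peak m f j.-1))).
  apply: eq_bigr => j _; rewrite /flat_slot.
  case: (eqVneq (j : nat) 0) => [->|nj0] /=; first by rewrite (ltn_eqF m_gt0).
  case: (eqVneq (j : nat) m) => [->|njm] /=; first by rewrite pkm pkm' andbF.
  have := @is_peakN m f j.-1; rewrite prednK ?lt0n //=.
  by case: is_peak => [/(_ isT) /negbTE ->|_] //=; rewrite andbF orbF !addn0 add0n.
rewrite !big_split /=.
have -> : \sum_(j < m.+1) (j == 0 :> nat) = 1.
  by rewrite big_ord_recl big1.
have -> : \sum_(j < m.+1) (j == m :> nat) = 1.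
  rewrite big_ord_recr /= eqxx big1 // => i _; by rewrite ltn_eqF.
rewrite big_ord_recr /= pkm big_ord_recl /=.
set S := (\sum_(i < m) _)%N; lia.
Qed.

Local Open Scope ring_scope.

Lemma sum_peaks_insert_max m f (g : nat -> nat -> nat) :
  (forall j, (j <= m.+1)%N -> inserts_max m.+1 f (g j) j) ->
  \sum_(j < m.+2) 'X^(\sum_(i < m.+2) is_peak m.+2 (g j) i)%N =
  peak_step m 'X^(\sum_(i < m.+1) is_peak m.+1 f i)%N.
Proof.
move=> ins; set k := (\sum_(i < m.+1) _)%N.
rewrite -['X^k]scale1r peak_stepZXn scale1r.
transitivity (\sum_(j < m.+2) ((flat_slot m.+1 f j)%:R *: 'X^k
     + (1 - (flat_slot m.+1 f j)%:R) *: 'X^(k.+1)) : {poly int}).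
  apply: eq_bigr => j _.
  have := peaks_insert_max (ltn0Sn m) (ltn_ord j) (ins j (ltn_ord j)).
  rewrite -/k; case: flat_slot; rewrite ?addn1 ?addn0 => E.
    by case: E => ->; rewrite subrr scale1r scale0r addr0.
  by rewrite E subr0 scale1r scale0r add0r.
rewrite big_split /= -!scaler_suml sumrB -natr_sum sum_flat_slot // -/k.
congr (_ + _ *: _); rewrite sumr_const card_ord; lia.
Qed.

Local Close Scope ring_scope.

(** Values are read through [nat], with the junk value 0 outside the domain,
    so that neighbouring positions are reached by successor and predecessor. *)
Definition perm_val (n : nat) (s : 'S_n) (i : nat) : nat :=
  if insub i is Some x then s x else 0.

Lemma perm_val_ord n (s : 'S_n) (i : 'I_n) : perm_val s i = s i.
Proof. by rewrite /perm_val valK. Qed.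

Lemma ipkE n (s : 'S_n) : ipk s = \sum_(i < n) is_peak n (perm_val s) i.
Proof.
rewrite /ipk -sum1_card big_mkcond /=; apply: eq_bigr => i _.
rewrite inE; set b := [exists a, _]; suff -> : b = is_peak n (perm_val s) i.
  by case: is_peak.
apply/existsP/and4P => [[a /existsP[c /and4P[/eqP ia /eqP ci lta ltc]]]|].
  split; first by rewrite ia.
  - by rewrite -ci.
  - by have -> : i.-1 = a; rewrite ?ia // -ia !perm_val_ord.
  - by rewrite -ci !perm_val_ord.
case=> i_gt0 ltin.
have lti' : i.-1 < n by rewrite (leq_ltn_trans (leq_pred _)).
rewrite (perm_val_ord s i) -[i.-1]/(nat_of_ord (Ordinal lti')).
rewrite -[i.+1]/(nat_of_ord (Ordinal ltin)) !perm_val_ord => l1 l2.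
exists (Ordinal lti'); apply/existsP; exists (Ordinal ltin).
by rewrite /= prednK // !eqxx l1 l2.
Qed.

Lemma inserts_max_lift_perm n (s : 'S_n) (j : 'I_n.+1) :
  inserts_max n (perm_val s) (perm_val (lift_perm j ord_max s)) j.
Proof.
move=> i ltin; rewrite -[i]/(nat_of_ord (Ordinal ltin)).
rewrite -[bump _ _]/(nat_of_ord (lift j (Ordinal ltin))) !perm_val_ord.
by rewrite lift_perm_lift lift_perm_id lift_max.
Qed.

(** The position of the maximum and the word left after its removal determine
    the permutation; surjectivity is by cardinality. *)
Lemma lift_max_bij n :
  bijective (fun p : 'S_n * 'I_n.+1 => lift_perm p.2 ord_max p.1).
Proof.
apply: inj_card_bij => [[s j] [s' j'] /= eq_lift|]; last first.
  have cardS m : #|{: 'S_m}| = m`! by rewrite card_Sn.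
  by rewrite card_prod !cardS card_ord factS mulnC.
have eqj : j = j'.
  apply: (@perm_inj _ (lift_perm j ord_max s)).
  by rewrite [in RHS]eq_lift !lift_perm_id.
subst j'; congr (_, _); apply/permP => k.
by apply: (@lift_inj _ ord_max); rewrite -!(lift_perm_lift j) eq_lift.
Qed.

Lemma sum_perm_insert_max n (F : 'S_n.+1 -> {poly int}) :
  (\sum_t F t = \sum_(s : 'S_n) \sum_j F (lift_perm j ord_max s))%R.
Proof. by rewrite pair_big (reindex _ (onW_bij _ (lift_max_bij n))). Qed.

Lemma W_recurrence n : W n.+2 = peak_step n (W n.+1).
Proof.
rewrite /W sum_perm_insert_max peak_step_sum; apply: eq_bigr => s _.
pose g j := perm_val (lift_perm (inord j) ord_max s).
rewrite ipkE -(@sum_peaks_insert_max n _ g) => [|j lejn].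
  by apply: eq_bigr => j _; rewrite ipkE /g inord_val.
by rewrite -{2}(@inordK n.+1 j) //; apply: inserts_max_lift_perm.
Qed.

Lemma W1 : W 1 = 1%R.
Proof.
rewrite /W (eq_bigr (fun=> 1%R)) => [|s _].
  by rewrite sumr_const card_Sn.
by rewrite ipkE big_ord1.
Qed.

(** * Tableaux with at most two columns *)

(** The rows of the tableau whose two columns are [A] and [B]; entries of [B]
    beyond the height of [A] are lost. *)
Fixpoint two_col (A B : seq nat) : seq (seq nat) :=
  if A is a :: A' then (a :: take 1 B) :: two_col A' (behead B) else [::].

Lemma size_two_col A B : size (two_col A B) = size A.
Proof. by elim: A B => //= a A IH B; rewrite IH. Qed.

Lemma column1_two_col A B : column 1 (two_col A B) = A.
Proof. by elim: A B => //= a A IH B; rewrite -{2}(IH (behead B)). Qed.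

Lemma column2_two_col A B : size B <= size A -> column 2 (two_col A B) = B.
Proof.
elim: A B => [|a A IH] [|b B] //= leBA; rewrite /column /=.
  exact: IH.
by rewrite -[in RHS](IH B).
Qed.

Lemma column_gt2_two_col k A B : 2 < k -> column k (two_col A B) = [::].
Proof.
move=> k_gt2; elim: A B => //= a A IH B; rewrite /column /= -/(column k _).
have /negbTE -> : ~~ (k <= (size (take 1 B)).+1).
  by case: B => [|b B] /=; rewrite ?take0 /=; lia.
exact: IH.
Qed.

Lemma shape_two_col A B : size B <= size A ->
  shape (two_col A B) = nseq (size B) 2 ++ nseq (size A - size B) 1.
Proof.
elim: A B => [|a A IH] [|b B] //= leBA; last by rewrite take0 IH // subSS.
by rewrite IH //= subn0.
Qed.

Lemma perm_flatten_two_col A B : size B <= size A ->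
  perm_eq (flatten (two_col A B)) (A ++ B).
Proof.
elim: A B => [|a A IH] [|b B] //= leBA; rewrite perm_cons; first exact: IH.
rewrite take0 /= -[b :: B]cat1s perm_sym perm_catCA /= perm_cons perm_sym; exact: IH.
Qed.

(** Dominance is expressed with [nth] rather than row by row because the former
    is stable under adding an entry on top of a column. *)
Lemma rows_sorted_two_col A B : size B <= size A ->
  all (sorted ltn) (two_col A B) =
  all (fun i => nth 0 A i < nth 0 B i) (iota 0 (size B)).
Proof.
elim: A B => [|a A IH] [|b B] //= leBA; first by rewrite IH.
by rewrite take0 /= andbT IH // (iotaDl 1 0) all_map.
Qed.

Lemma column2_short_rows T : all (geq 1) (shape T) -> column 2 T = [::].
Proof.
elim: T => //= r T IH /andP[short_r /IH].
by rewrite /column /= ltnNge short_r.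
Qed.

(** Row lengths decrease, so the rows of length 2 come first and no entry of the
    second column has a gap below it. *)
Lemma two_col_columns T :
  sorted geq (shape T) -> 0 \notin shape T -> all (fun c => c <= 2) (shape T) ->
  T = two_col (column 1 T) (column 2 T) /\ size (column 2 T) <= size (column 1 T).
Proof.
elim: T => //= r T IH sT; rewrite in_cons negb_or => /andP[r_nz nzT] /andP[ler leT].
have [eT le21] := IH (path_sorted sT) nzT leT.
case: r => [|a [|b [|c r]]] // in sT r_nz ler *.
  have col2 : column 2 T = [::].
    by apply: column2_short_rows; apply: order_path_min sT => x y z /= xy /leq_trans->.
  rewrite /column /= -/(column 1 T) -/(column 2 T) col2; split=> //.
  by rewrite {1}eT col2.
rewrite /column /= -/(column 1 T) -/(column 2 T); split=> //.
by rewrite take0 -eT.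
Qed.

Definition ballot_pair (n : nat) (A B : seq nat) : bool :=
  [&& size B <= size A, sorted ltn A, sorted ltn B,
      all (fun i => nth 0 A i < nth 0 B i) (iota 0 (size B))
    & perm_eq (A ++ B) (iota 1 n)].

Lemma sorted_shape_two_col A B :
  size B <= size A -> sorted geq (shape (two_col A B)).
Proof.
have path1 q c : 0 < c -> path geq c (nseq q 1).
  by elim: q c => //= q IH c ->; apply: IH.
move=> leBA; rewrite shape_two_col //.
move: (_ - _) => q; elim: (size B) => [|p IH] /=.
  by case: q => //= q; apply: path1.
by case: p IH => //= _; apply: path1.
Qed.

(** Only the first two columns matter in the column condition, and when [n < 2]
    the columns that [is_standard] does not test have at most one entry. *)
Lemma standard_two_colE n A B : size B <= size A ->
  is_standard n (two_col A B) = ballot_pair n A B.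
Proof.
move=> leBA; rewrite /is_standard /ballot_pair leBA /= rows_sorted_two_col //.
have permE := perm_flatten_two_col leBA.
rewrite (permPl permE).
case: (boolP (perm_eq (A ++ B) (iota 1 n))) => [pAB|]; last by rewrite !andbF.
have szn := perm_size pAB; rewrite size_cat size_iota in szn.
have -> : is_partition n (shape (two_col A B)).
  rewrite /is_partition sorted_shape_two_col // -size_flatten (perm_size permE).
  rewrite size_cat szn eqxx shape_two_col // mem_cat.
  by rewrite !mem_nseq !andbF.
case: (all _ (iota 0 _)); rewrite ?andbF //= andbT.
apply/allP/andP => [colS|[sA sB] k].
  split; first rewrite -(column1_two_col A B); last rewrite -(column2_two_col leBA).
    case: (posnP n) => [n0|n_gt0]; last by apply: colS; rewrite mem_iota; lia.
    by rewrite column1_two_col; case: (A) szn; rewrite n0.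
  case: (leqP n 1) => [n1|n_gt1]; last by apply: colS; rewrite mem_iota; lia.
  by rewrite column2_two_col //; move: szn leBA; case: (B) => [|? [|? ?]] //=; lia.
rewrite mem_iota => /andP[k_gt0 _].
case: k k_gt0 => [|[|[|k]]] // _; first by rewrite column1_two_col.
  by rewrite column2_two_col.
by rewrite column_gt2_two_col.
Qed.

(** * Adding and removing the largest entry *)

Lemma ballot_pair_mem n A B x : ballot_pair n A B -> (x \in A ++ B) = (0 < x <= n).
Proof. by move=> /and5P[_ _ _ _ /perm_mem->]; rewrite mem_iota. Qed.

Lemma sorted_ltn_rcons s x :
  sorted ltn (rcons s x) = all (fun y => y < x) s && sorted ltn s.
Proof. by rewrite !(sorted_pairwise ltn_trans) pairwise_rcons. Qed.

Lemma perm_iota_insert n A B :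
  perm_eq (A ++ n.+1 :: B) (iota 1 n.+1) = perm_eq (A ++ B) (iota 1 n).
Proof.
rewrite -cat1s perm_catCA -[X in iota 1 X]addn1 iotaD /=.
by rewrite cats1 perm_sym perm_rcons perm_cons perm_sym.
Qed.

Lemma sorted_max_last s x : sorted ltn s -> x \in s -> all (fun y => y <= x) s ->
  exists s', s = rcons s' x.
Proof.
case/lastP: s => // s y; rewrite sorted_ltn_rcons => /andP[/allP lts _].
rewrite mem_rcons in_cons all_rcons => /orP[/eqP->|xs] /andP[leyx _]; first by exists s.
by have := lts _ xs; rewrite ltnNge leyx.
Qed.

(** If the columns have equal heights before the removal of [n.+1] from the first
    one, the entry of [B] to the right of [n.+1] would exceed it. *)
Lemma ballot_pair_rconsl n A B :
  ballot_pair n.+1 (rcons A n.+1) B = ballot_pair n A B.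
Proof.
apply/idP/idP => bp; have mem x := ballot_pair_mem x bp;
  case/and5P: bp => leBA sA sB /allP dom pAB; apply/and5P.
  (* Otherwise B has an entry next to n.+1, hence larger than n.+1. *)
  have leBA' : size B <= size A.
    rewrite leqNgt; apply/negP => ltAB.
    have := dom (size A); rewrite mem_iota add0n => /(_ ltAB).
    rewrite nth_rcons ltnn eqxx => lt.
    have := mem (nth 0 B (size A)); rewrite mem_cat mem_nth // orbT.
    by case/esym/andP=> _; rewrite leqNgt lt.
  rewrite cat_rcons perm_iota_insert in pAB.
  move: sA; rewrite sorted_ltn_rcons => /andP[_ sA]; split=> //.
  apply/allP => i iB; have := dom i iB; move: iB; rewrite mem_iota add0n /= => iB.
  by rewrite nth_rcons (leq_trans iB).
rewrite cat_rcons perm_iota_insert size_rcons sorted_ltn_rcons.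
split=> //; first exact: leqW.
  by rewrite sA andbT; apply/allP => x xA; have := mem x; rewrite mem_cat xA; lia.
apply/allP => i iB; have := dom i iB; move: iB; rewrite mem_iota add0n /= => iB.
by rewrite nth_rcons (leq_trans iB).
Qed.

Lemma ballot_pair_rconsr n A B :
  ballot_pair n.+1 A (rcons B n.+1) = ballot_pair n A B && (size B < size A).
Proof.
rewrite /ballot_pair size_rcons sorted_ltn_rcons.
case: (ltnP (size B) (size A)) => ltBA; last by rewrite andbF.
have -> : perm_eq (A ++ rcons B n.+1) (iota 1 n.+1) = perm_eq (A ++ B) (iota 1 n).
  by rewrite -rcons_cat -cats1 perm_iota_insert cats0.
rewrite (ltnW ltBA) andbT -[(size B).+1]addn1 iotaD all_cat /= andbT add0n.
case: (boolP (perm_eq _ _)) => [pAB|]; last by rewrite !andbF.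
have mem x : x \in A ++ B -> x < n.+1 by rewrite (perm_mem pAB) mem_iota => /andP[].
have -> : all (fun y => y < n.+1) B.
  by apply/allP => x xB; apply: mem; rewrite mem_cat xB orbT.
rewrite nth_rcons ltnn eqxx mem ?mem_cat ?mem_nth // !andbT.
congr [&& _, _ & _]; apply: eq_in_all => i; rewrite mem_iota => /andP[_ ltiB].
by rewrite nth_rcons ltiB.
Qed.

(** The largest entry has to be the last one of a sorted column. *)
Lemma ballot_pair_rcons_exists n A B : ballot_pair n.+1 A B ->
  (exists A', A = rcons A' n.+1) \/ (exists B', B = rcons B' n.+1).
Proof.
move=> bp; have mem x := ballot_pair_mem x bp.
case/and5P: bp => _ sA sB _ _.
have := mem n.+1; rewrite mem_cat ltnSn /= => /orP[nA|nB]; [left|right].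
  apply: sorted_max_last => //; apply/allP => x xA.
  by have := mem x; rewrite mem_cat xA; lia.
apply: sorted_max_last => //; apply/allP => x xB.
by have := mem x; rewrite mem_cat xB orbT; lia.
Qed.

(** * Enumeration of the tableaux *)

Fixpoint ballot_pairs (n : nat) : seq (seq nat * seq nat) :=
  if n is m.+1 then
    [seq (rcons p.1 n, p.2) | p <- ballot_pairs m] ++
    [seq (p.1, rcons p.2 n) | p <- ballot_pairs m & size p.2 < size p.1]
  else [:: ([::], [::])].

Lemma mem_ballot_pairs n A B : ((A, B) \in ballot_pairs n) = ballot_pair n A B.
Proof.
elim: n A B => [|n IH] A B.
  rewrite inE; apply/eqP/idP => [[-> ->] //|/and5P[_ _ _ _ /perm_size]].
  by rewrite size_cat; case: A; case: B.
rewrite [ballot_pairs _]/= mem_cat; apply/orP/idP => [[]|bp].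
- by case/mapP => -[A' B'] /=; rewrite IH => bp [-> ->]; rewrite ballot_pair_rconsl.
- case/mapP => -[A' B'] /=; rewrite mem_filter IH => /andP[lt bp] [-> ->].
  by rewrite ballot_pair_rconsr bp.
- case: (ballot_pair_rcons_exists bp) => -[s eqs]; [left|right]; apply/mapP; subst.
    by exists (s, B) => //; rewrite IH -ballot_pair_rconsl.
  by exists (A, s) => //; rewrite mem_filter IH andbC -ballot_pair_rconsr.
Qed.

Lemma ballot_pairs_uniq n : uniq (ballot_pairs n).
Proof.
elim: n => //= n IH; rewrite cat_uniq !map_inj_uniq.
- rewrite filter_uniq IH ?andbT //=; apply/hasPn => p /mapP[[A B]].
  rewrite mem_filter mem_ballot_pairs => /andP[_ bp] -> /=.
  apply/mapP => -[[A' B'] _ /= [eA _]].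
  have := ballot_pair_mem n.+1 bp.
  by rewrite eA mem_cat mem_rcons mem_head ltnn.
- by move=> [A B] [A' B'] /= [-> /rcons_inj[->]].
- by move=> [A B] [A' B'] /= [/rcons_inj[->] ->].
Qed.

Lemma rows_inj n : injective (@rows n).
Proof.
move=> t u eq_rows; apply: val_inj.
by apply: inj_map eq_rows => r s /(inj_map val_inj)/val_inj.
Qed.

(** The rows of a standard tableau are nonempty and their lengths add up to [n],
    which bounds their number and their lengths by [n]. *)
Lemma rows_surj n T : is_standard n T -> exists t : filling n, rows t = T.
Proof.
case/and4P => /and3P[_ nz /eqP sum_n] /perm_mem memT _ _.
have size_le : size T <= n.
  rewrite -sum_n; elim: T nz {sum_n memT} => //= r T IH.
  by rewrite in_cons negb_or => /andP[r_nz /IH]; case: r r_nz => //= *; lia.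
have row_le r : r \in T -> size r <= n.
  rewrite -sum_n -size_flatten => /splitPr[T1 T2].
  by rewrite flatten_cat /= !size_cat; lia.
exists (insub_bseq n [seq insub_bseq n [seq inord x | x <- r] | r <- T]).
rewrite /rows insubdK ?unfold_in ?size_map // -map_comp map_id_in // => r rT /=.
rewrite insubdK ?unfold_in ?size_map ?row_le // -map_comp map_id_in // => x xr /=.
rewrite inordK //; have := memT x; rewrite mem_iota.
by have -> : x \in flatten T; [apply/flattenP; exists r | case/esym/andP].
Qed.

Lemma perm_SYT_cols2 n :
  perm_eq [seq rows t | t <- enum (SYT_cols n 2)]
          [seq two_col p.1 p.2 | p <- ballot_pairs n].
Proof.
apply: uniq_perm.
- by rewrite map_inj_uniq ?enum_uniq //; apply: rows_inj.
- rewrite map_inj_in_uniq ?ballot_pairs_uniq // => -[A B] [A' B'].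
  rewrite !mem_ballot_pairs => /and5P[le _ _ _ _] /and5P[le' _ _ _ _] /= eqT.
  have /= eqA := congr1 (column 1) eqT; have /= eqB := congr1 (column 2) eqT.
  by rewrite !column1_two_col !column2_two_col // in eqA eqB; rewrite eqA eqB.
move=> T; apply/mapP/mapP => [[t]|[[A B]]].
  rewrite mem_enum !inE => /andP[stdT le2] eqT; subst T.
  have /and4P[/and3P[sT nz _] _ _ _] := stdT.
  have [eT le21] := two_col_columns sT nz le2.
  exists (column 1 (rows t), column 2 (rows t)) => //=.
  by rewrite mem_ballot_pairs -standard_two_colE // -eT.
rewrite mem_ballot_pairs => bp /= ->; have /andP[le _] := bp.
rewrite -standard_two_colE // in bp; have [t et] := rows_surj bp.
exists t => //; rewrite mem_enum !inE et bp /= shape_two_col //.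
by rewrite all_cat !all_nseq !orbT.
Qed.

(** * Box sorting indices and the weighted sum *)

Lemma column_of_two_col i A B :
  size B <= size A -> uniq (A ++ B) -> i \in A ++ B ->
  column_of i (two_col A B) = if i \in A then 1 else 2.
Proof.
rewrite /column_of mem_cat.
elim: A B => [|a A IH] [|b B] //= leBA; rewrite !in_cons.
  rewrite cats0 orbF => /andP[_ uA] iA; case: (eqVneq i a) iA => [-> _|nia iA] /=.
    by rewrite eqxx.
  by rewrite IH ?cats0 ?orbF ?iA //= orbF.
rewrite take0 /= !in_nil mem_cat in_cons !negb_or => /andP[/and3P[naA nab _]].
rewrite cat_uniq /= negb_or => /and3P[uA /andP[nbA dAB] /andP[nbB uB]].
have uAB : uniq (A ++ B) by rewrite cat_uniq uA dAB.
case: (eqVneq i a) => [->|nia] /=; first by rewrite eqxx.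
case: (eqVneq i b) => [->|nib] /= iAB; last by rewrite IH.
by rewrite (negbTE nab) eqxx (negbTE nbA).
Qed.

Lemma col_sizes_restrict_two_col i A B :
  size B <= size A -> all (sorted ltn) (two_col A B) ->
  col_size 1 (restrict (two_col A B) i) = count (leq^~ i) A /\
  col_size 2 (restrict (two_col A B) i) = count (leq^~ i) B.
Proof.
rewrite /col_size /column /restrict.
elim: A B => [|a A IH] [|b B] //= leBA; rewrite ?take0 /=.
  by case/(IH [::] isT) => <- /= e2; case: (a <= i); rewrite /= e2.
rewrite andbT => /andP[ltab /(IH B leBA)[<- <-]].
by case: (leqP b i) => [/(leq_trans (ltnW ltab)) ->|_] //=; case: (a <= i).
Qed.

(** The box sorting index in terms of the columns.  The height of a column of the
    tableau restricted to the entries up to [i] is the number of such entries in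
    the full column. *)
Definition pair_index (i : nat) (A B : seq nat) : nat :=
  if i \in A then i - count (leq^~ i) A + 1
  else count (leq^~ i) A - count (leq^~ i) B + 1.

Lemma box_sorting_index_two_col n i A B :
  ballot_pair n A B -> 0 < i <= n ->
  box_sorting_index i (two_col A B) = pair_index i A B.
Proof.
move=> bp i_bnd; have iAB := ballot_pair_mem i bp.
case/and5P: bp => leBA sA sB dom pAB.
have uAB : uniq (A ++ B) by rewrite (perm_uniq pAB) iota_uniq.
rewrite -rows_sorted_two_col // in dom.
have [c1 c2] := col_sizes_restrict_two_col i leBA dom.
rewrite /box_sorting_index column_of_two_col ?iAB // /pair_index.
by case: (i \in A); rewrite /= c1 ?c2.
Qed.

Local Open Scope ring_scope.

Definition pair_term (n : nat) (A B : seq nat) : {poly int} :=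
  (2 ^ size A * \prod_(1 <= i < n.+1) pair_index i A B)%N%:R *: 'X^(size B).

(** The indices of the entries up to [n] only depend on where these entries lie,
    so a new entry [n.+1] leaves them unchanged. *)
Lemma eq_prod_pair_index n A B C D :
    ballot_pair n A B ->
    (forall i, (i <= n)%N -> (i \in C) = (i \in A)) ->
    (forall i, (i <= n)%N -> count (leq^~ i) C = count (leq^~ i) A) ->
    (forall i, (i <= n)%N -> count (leq^~ i) D = count (leq^~ i) B) ->
  (\prod_(1 <= i < n.+1) pair_index i C D = \prod_(1 <= i < n.+1) pair_index i A B)%N.
Proof.
move=> bp mC cC cD; apply: eq_big_nat => i /andP[_ lein].
by rewrite /pair_index mC // cC // cD.
Qed.

(** The entry [n.+1] contributes [n.+1 - (size A).+1 + 1 = (size B).+1] in the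
    first column and [size A - (size B).+1 + 1 = size A - size B] in the second
    one; the result is the image of the monomial ['X^(size B)] because
    [size A - size B = n - 2 * size B]. *)
Lemma pair_term_step n A B : ballot_pair n A B ->
  pair_term n.+1 (rcons A n.+1) B
    + (if (size B < size A)%N then pair_term n.+1 A (rcons B n.+1) else 0)
  = peak_step n (pair_term n A B).
Proof.
move=> bp.
have szn : (size A + size B)%N = n.
  by case/and5P: bp => _ _ _ _ /perm_size; rewrite size_cat size_iota.
have le_n x : x \in A ++ B -> (x <= n)%N by rewrite (ballot_pair_mem _ bp) => /andP[].
have leBA : (size B <= size A)%N by case/andP: bp.
have cnt_rcons s i : (i <= n)%N -> count (leq^~ i) (rcons s n.+1) = count (leq^~ i) s.
  by move=> lein; rewrite -cats1 count_cat /= leqNgt ltnS lein !addn0.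
have cntA : count (leq^~ n.+1) A = size A.
  apply/eqP; rewrite -all_count; apply/allP => x xA.
  by apply/leqW/le_n; rewrite mem_cat xA.
have cntB : count (leq^~ n.+1) B = size B.
  apply/eqP; rewrite -all_count; apply/allP => x xA.
  by apply/leqW/le_n; rewrite mem_cat xA orbT.
have nA : n.+1 \in A = false.
  by apply/negP => xA; have := le_n n.+1; rewrite mem_cat xA ltnn => /(_ isT).
have newA : pair_index n.+1 (rcons A n.+1) B = (size B).+1.
  rewrite /pair_index mem_rcons mem_head -cats1 count_cat cntA /= leqnn; lia.
have newB : (size B < size A)%N ->
    pair_index n.+1 A (rcons B n.+1) = (size A - size B)%N.
  rewrite /pair_index nA -cats1 count_cat cntA cntB /= leqnn; lia.
rewrite /pair_term peak_stepZXn !(big_nat_recr n.+1) //= newA.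
rewrite (@eq_prod_pair_index n A B (rcons A n.+1) B) //;
  try by move=> *; rewrite ?cnt_rcons.
  2: by move=> i lein; rewrite mem_rcons in_cons ltn_eqF.
rewrite (@eq_prod_pair_index n A B A (rcons B n.+1)) //; last exact: cnt_rcons.
rewrite !size_rcons; set w := (\prod_(1 <= i < n.+1) _)%N.
have -> : n%:R - (2 * size B)%:R = (size A - size B)%N%:R :> int by lia.
case: ltnP => [ltBA|leAB].
  rewrite newB // scalerDr !scalerA -!natrM expnS.
  by congr (_%:R *: _ + _%:R *: _); ring.
have -> : (size A - size B = 0)%N by lia.
by rewrite scale0r !addr0 scalerA -natrM expnS; congr (_%:R *: _); ring.
Qed.

Definition pair_sum (n : nat) : {poly int} :=
  \sum_(p <- ballot_pairs n) pair_term n p.1 p.2.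

Lemma pair_sum_recurrence n : pair_sum n.+1 = peak_step n (pair_sum n).
Proof.
rewrite /pair_sum peak_step_sum /= big_cat !big_map big_filter /=.
rewrite [X in _ + X = _]big_mkcond /=.
rewrite -big_split; apply: eq_big_seq => -[A B] /=.
rewrite mem_ballot_pairs; exact: pair_term_step.
Qed.

Lemma pair_sumE n :
  pair_sum n =
  \sum_(T in SYT_cols n 2)
     (2 ^ size (shape (rows T)) *
      \prod_(1 <= i < n.+1) box_sorting_index i (rows T))%N%:R
     *: 'X^(n - size (shape (rows T))).
Proof.
pose F (T : seq (seq nat)) : {poly int} :=
  (2 ^ size (shape T) * \prod_(1 <= i < n.+1) box_sorting_index i T)%N%:R
     *: 'X^(n - size (shape T)).
transitivity (\sum_(T <- [seq rows t | t <- enum (SYT_cols n 2)]) F T); last first.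
  by rewrite big_map big_enum.
rewrite (perm_big _ (perm_SYT_cols2 n)) big_map; apply: eq_big_seq => -[A B].
rewrite mem_ballot_pairs /= => bp; rewrite /F size_map size_two_col.
have szn : (size A + size B)%N = n.
  by case/and5P: bp => _ _ _ _ /perm_size; rewrite size_cat size_iota.
rewrite /pair_term -{3}szn addKn; congr ((_ * _)%N%:R *: _).
apply: eq_big_nat => i i_bnd; exact/esym/(box_sorting_index_two_col bp).
Qed.

Local Close Scope ring_scope.

Theorem theorem34 (n : nat) (hn : 1 <= n) :
  W n.+1 =
  (\sum_(T in SYT_cols n 2)
     (2 ^ size (shape (rows T)) *
      \prod_(1 <= i < n.+1) box_sorting_index i (rows T))%N%:R
     *: 'X^(n - size (shape (rows T))))%R.
Proof.
rewrite -pair_sumE => {hn}; elim: n => [|n IH].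
  by rewrite W1 /pair_sum big_seq1 /pair_term big_geq // scale1r.
by rewrite W_recurrence IH pair_sum_recurrence.
Qed.
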